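(* (a) Let $\gamma=g_1*\dots*g_s\in\Gamma$ with $s\ge1$. Then $\theta(\gamma)=f_{\varepsilon(c(\gamma))}$. (b) A number $n\in\mathbb{N}$ is essential if and only if either $n=0$, or $\mu_1(n)$ is odd and $\mu_1(n)\ge3$. (c) A number $n\in\mathbb{N}$ is essential if and only if $n=\lfloor m\tau\rfloor+\lfloor m\tau^2\rfloor$ for some $m\in\mathbb{N}$, where $\tau=(1+\sqrt5)/2$.
   Context: Let $f_0=f_1=1$, $f_i=f_{i-1}+f_{i-2}$ ($i\ge2$); for a finite set $I$ of positive integers let $f_I=\sum_{i\in I}f_i$. A 2-partition is a finite set of positive integers with consecutive differences $\ge2$; $Z(n)=\{\mu_1(n)<\dots<\mu_q(n)\}$ is the unique 2-partition with $n=f_{Z(n)}$ (Zeckendorf). The canonical form of a nonempty 2-partition is its decomposition into maximal runs $I_1,\dots,I_s$ of consecutive elements of equal parity. The associated vector of $\{i_1<\dots<i_q\}$ is $(\alpha_1,\dots,\alpha_q)$, $\alpha_1=\lfloor(i_1-1)/2\rfloor+1$, $\alpha_r=\lfloor(i_r-i_{r-1})/2\rfloor+1$; cutting it into consecutive blocks of lengths $|I_1|,\dots,|I_s|$ gives $\mathcal{V}(I)=B_1\times\cdots\times B_s$. Define integers $D(\emptyset)=1$, $D(\alpha_1)=\alpha_1$, $D(\alpha_1,\dots,\alpha_r)=\alpha_rD(\alpha_1,\dots,\alpha_{r-1})-D(\alpha_1,\dots,\alpha_{r-2})$. Let $\mathcal{A}_1$ be the set of integer vectors $(\alpha_1,\dots,\alpha_q)$,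 $q\ge1$, with $\alpha_1\ge1$, $\alpha_2,\dots,\alpha_q\ge2$; for $B=(\beta_1,\dots,\beta_q)\in\mathcal{A}_1$ let $\langle B\rangle=D(\beta_2,\dots,\beta_q)/D(\beta_1,\dots,\beta_q)>0$. For each rational $g>0$ there is a unique $c(g)\in\mathcal{A}_1$ with $\langle c(g)\rangle=g$. Let $\Gamma$ be the free monoid generated by the nonzero elements of $\mathbb{Q}/\mathbb{Z}$, each identified with its representative fraction in $(0,1)$; its elements are words $g_1*\dots*g_s$ ($s\ge0$). For $\gamma=g_1*\dots*g_s$ put $c(\gamma)=c(g_1)\times\dots\times c(g_s)$ (a tuple of vectors). Define $\pi:\mathbb{N}\to\Gamma$ by $\pi(0)=$ unit and, for $n\ge1$ with $\mathcal{V}(Z(n))=B_1\times\cdots\times B_s$, $\pi(n)=\overline{\langle B_1\rangle}*\langle B_2\rangle*\cdots*\langle B_s\rangle$, where $\overline{\langle B_1\rangle}$ is the class of $\langle B_1\rangle$ in $\mathbb{Q}/\mathbb{Z}$ (omitted if $0$). $\pi$ is surjective; for $\gamma\in\Gamma$, $\theta(\gamma)$ is the smallest element of $\pi^{-1}(\gamma)$. A number $n$ is essential if $n=\theta(\pi(n))$. For a vector $B=(\beta_1,\dots,\beta_q)$ let $d(B)=\beta_1+\dots+\beta_q-q$ and $\varepsilon(B)=\{2d(\beta_1)+1,2d(\beta_1,\beta_2)+1,\dots,2d(\beta_1,\dots,\beta_q)+1\}$. Let $\sigma^m$ add $m$ to every element of a set. For $B_1\times\dots\times B_s$ put $\varepsilon(B_1\times\dots\times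 B_s)=\varepsilon(B_1)\cup\sigma^{2d(B_1)+1}(\varepsilon(B_2))\cup\dots\cup\sigma^{2d(B_1)+\dots+2d(B_{s-1})+s-1}(\varepsilon(B_s))$. *)

(* Defs.v *)
From HB Require Import structures.
From mathcomp Require Import all_boot all_order all_algebra finmap.
From mathcomp Require Import reals.
From mathcomp Require Import zify ring lra.

Set Implicit Arguments.
Unset Strict Implicit.
Unset Printing Implicit Defensive.

Import Order.TTheory GRing.Theory Num.Theory.

Local Open Scope nat_scope.

Fixpoint fib (n : nat) : nat :=
  if n is (m.+1 as k).+1 then fib k + fib m else 1.
Arguments fib : simpl never.

Definition fibsum (I : {fset nat}) : nat := \sum_(i <- I) fib i.

(* i_1 < ... < i_q *)
Definition elems (I : {fset nat}) : seq nat := sort leq I.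

Definition gap2 : rel nat := fun i j => i + 2 <= j.

Definition is_2partition (I : {fset nat}) : bool :=
  (0 \notin I) && sorted gap2 (elems I).

Lemma fibSS n : fib n.+2 = fib n.+1 + fib n.
Proof. by []. Qed.

Lemma fib_gt0 n : 0 < fib n.
Proof.
suff: (0 < fib n) && (0 < fib n.+1) by case/andP.
elim: n => [//|n /andP[h1 h2]]; rewrite h2 fibSS; lia.
Qed.

Lemma leq_fib m n : m <= n -> fib m <= fib n.
Proof.
apply: (homo_leq (r := leq)) => [//|a b c|]; first exact: leq_trans.
by case=> [//|k]; rewrite fibSS leq_addr.
Qed.

Lemma ltn_fibS n : 0 < n -> fib n < fib n.+1.
Proof. by case: n => // n _; rewrite fibSS; have := fib_gt0 n; lia. Qed.

Lemma leqn_fib n : n <= fib n.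
Proof.
suff: (n <= fib n) && (n.+1 <= fib n.+1) by case/andP.
elim: n => [//|n /andP[h1 h2]]; rewrite h2 fibSS.
by have := fib_gt0 n; lia.
Qed.

Lemma gap2_trans : transitive gap2.
Proof. by move=> a b c; rewrite /gap2; lia. Qed.

Lemma sorted_gap2_ltn s : sorted gap2 s -> sorted ltn s.
Proof. by apply: sub_sorted => i j; rewrite /gap2 /=; lia. Qed.

Lemma elems_seq s : sorted ltn s -> elems [fset x in s]%fset = s.
Proof.
move=> ss; apply: (sorted_eq leq_trans anti_leq).
- exact: (sort_sorted leq_total).
- by apply: sub_sorted ss => i j /=; lia.
rewrite perm_sort; apply: uniq_perm; first exact: fset_uniq.
  by apply: (sorted_uniq ltn_trans ltnn).
by move=> x; rewrite /= in_fset.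
Qed.

Lemma mem_elems I : elems I =i I.
Proof. by move=> x; rewrite mem_sort. Qed.

Lemma elems_inj : injective elems.
Proof. by move=> I J eIJ; apply/fsetP => x; rewrite -mem_elems eIJ mem_elems. Qed.

Lemma fibsum_elems I : fibsum I = \sum_(i <- elems I) fib i.
Proof. by apply: perm_big; rewrite perm_sym perm_sort. Qed.

Lemma is_2partition_seq s : 0 \notin s -> sorted gap2 s ->
  is_2partition [fset x in s]%fset.
Proof.
move=> s0 ss; rewrite /is_2partition elems_seq ?ss ?sorted_gap2_ltn //.
by rewrite in_fset /= s0.
Qed.

Lemma zeckendorf_bound (s : seq nat) (k : nat) : 0 \notin rcons s k -> sorted gap2 (rcons s k) ->
  \sum_(i <- rcons s k) fib i < fib k.+1.
Proof.
elim/last_ind: s k => [|s j IHs] k.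
  rewrite /= big_seq1 inE => k0 _; apply: ltn_fibS; lia.
rewrite mem_rcons inE negb_or => /andP[k0 s0] h.
have hj : j + 2 <= k.
  by move: h; rewrite -cats1 -cats1 -catA /= sorted_cat_cons /= andbT => /andP[].
have hs : sorted gap2 (rcons s j) by move: h; rewrite -[rcons _ k]cats1 => /cat_sorted2[].
have {}IHs := IHs j s0 hs.
rewrite -cats1 big_cat big_seq1 /=.
case: k hj {k0 h} => [|[|k]] hj; try lia.
have hjk : j.+1 <= k.+1 by lia.
by have := leq_fib hjk; rewrite (fibSS k.+1); lia.
Qed.

Lemma zeckendorf_exists n :
  exists I : {fset nat}, is_2partition I && (fibsum I == n).
Proof.
suff [s [s0 ss <-]] : exists s, [/\ 0 \notin s, sorted gap2 s
    & \sum_(i <- s) fib i = n].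
  exists [fset x in s]%fset; rewrite is_2partition_seq //=.
  by rewrite fibsum_elems elems_seq // sorted_gap2_ltn.
have [m] := ubnP n; elim: m n => // m IHm n le_nm.
have [->|n0] := posnP n; first by exists [::]; rewrite big_nil.
have ex1 : exists k, (0 < k) && (fib k <= n) by exists 1.
have ub k : (0 < k) && (fib k <= n) -> k <= n.
  by case/andP=> _; apply: leq_trans; apply: leqn_fib.
case: (ex_maxnP ex1 ub) => k /andP[k0 kn] kmax.
have lt_n : n < fib k.+1.
  by rewrite ltnNge; apply/negP => h; have := kmax k.+1 h; rewrite ltnn.
have [|s [s0 ss sE]] := IHm (n - fib k); first by have := fib_gt0 k; lia.
have hlast i : i \in s -> i + 2 <= k.
  move=> si; case: k k0 kn lt_n sE {kmax} => // k _ kn lt_n sE.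
  have : fib i <= \sum_(i <- s) fib i by rewrite (big_rem i) //= leq_addr.
  rewrite sE => h; have hi : fib i < fib k by rewrite fibSS in lt_n; lia.
  suff : i < k by lia.
  by rewrite ltnNge; apply/negP => /leq_fib; lia.
exists (rcons s k); split.
- by rewrite mem_rcons inE negb_or s0 andbT; lia.
- move: ss; rewrite !(sorted_pairwise gap2_trans) pairwise_rcons => ->; rewrite andbT.
  by apply/allP => i /hlast.
by rewrite -cats1 big_cat big_seq1 sE /=; lia.
Qed.

Lemma zeckendorf_unique I J : is_2partition I -> is_2partition J ->
  fibsum I = fibsum J -> I = J.
Proof.
suff uniq_seq (s t : seq nat) : 0 \notin s -> sorted gap2 s -> 0 \notin t ->
    sorted gap2 t -> \sum_(i <- s) fib i = \sum_(i <- t) fib i -> s = t.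
  case/andP=> I0 sI /andP[J0 sJ] eIJ; apply: elems_inj; apply: uniq_seq => //.
  - by rewrite mem_elems.
  - by rewrite mem_elems.
  by rewrite -!fibsum_elems.
have pos (u : seq nat) (k : nat) : \sum_(i <- rcons u k) fib i >= fib k.
  by rewrite -cats1 big_cat big_seq1 leq_addl.
elim/last_ind: s t => [|s k IHs] t; case/lastP: t => [|t l] //.
- by rewrite big_nil => _ _ _ _ h; have := pos t l; have := fib_gt0 l; lia.
- by rewrite big_nil => _ _ _ _ h; have := pos s k; have := fib_gt0 k; lia.
move=> s0 ss t0 st e.
have bs := zeckendorf_bound s0 ss; have bt := zeckendorf_bound t0 st.
have ps := pos s k; have pt := pos t l.
have ekl : k = l.
  have [h|h|//] := ltngtP k l; first by have := leq_fib h; lia.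
  by have := leq_fib h; lia.
subst l; move: e ss st; rewrite -!cats1 !big_cat /= => /addIn e /cat_sorted2[ss _] /cat_sorted2[st _].
congr cat; apply: IHs => //.
  by apply: contra s0; rewrite mem_rcons inE orbC => ->.
by apply: contra t0; rewrite mem_rcons inE orbC => ->.
Qed.

Definition Z (n : nat) : {fset nat} := xchoose (zeckendorf_exists n).

Lemma Z_2partition n : is_2partition (Z n).
Proof. by case/andP: (xchooseP (zeckendorf_exists n)). Qed.

Lemma fibsum_Z n : fibsum (Z n) = n.
Proof. by case/andP: (xchooseP (zeckendorf_exists n)) => _ /eqP. Qed.

(* mu r n is the r-th smallest element of Z n, with r counted from 1; the value
   is 0 when Z n has fewer than r elements. *)
Definition mu (r n : nat) : nat := nth 0 (elems (Z n)) r.-1.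

Fixpoint runs (s : seq nat) : seq (seq nat) :=
  if s is i :: s' then
    match runs s' with
    | (j :: r) :: rs =>
        if odd i == odd j then (i :: j :: r) :: rs
        else [:: i] :: (j :: r) :: rs
    | _ => [:: [:: i]]
    end
  else [::].

(* Consecutive elements of equal parity, in runs that cannot be extended. *)
Definition parity_runs (rs : seq (seq nat)) : bool :=
  all (fun r => (r != [::]) && constant (map odd r)) rs &&
  sorted (fun r r' => odd (last 0 r) != odd (head 0 r')) rs.

Lemma runsP s : flatten (runs s) = s /\ parity_runs (runs s).
Proof.
elim: s => //= i s [IHf].
case: (runs s) IHf => [|[|j r] rs] /= <-; rewrite /parity_runs //= => /andP[].
move=> /andP[hj hrs] hp; case: (eqVneq (odd i) (odd j)) => [eij|nij] /=.
  split=> //; rewrite /parity_runs /= -eij eqxx /=; move: hj; rewrite -eij => -> /=.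
  by rewrite hrs /=; case: (rs) hp.
by split=> //; rewrite /parity_runs /= hj hrs nij.
Qed.

Lemma runs_unique rs : parity_runs rs -> runs (flatten rs) = rs.
Proof.
elim: rs => [//|r rs IHrs]; rewrite /parity_runs /= => /andP[/andP[hr hrs] hp].
have {}IHrs : runs (flatten rs) = rs.
  by apply: IHrs; rewrite /parity_runs hrs (path_sorted hp).
elim: r hr hp => [//|i [|j r] IHr] /= hr hp.
  rewrite IHrs; case: (rs) hrs hp => [//|[//|k r'] rs'] /= _ /andP[nik _].
  by rewrite (negbTE nik).
have /andP[/eqP eji hr'] := hr.
by rewrite /= in IHr; rewrite IHr ?eji ?eqxx //; case: (rs) hp.
Qed.

Definition canonical_form (I : {fset nat}) : seq (seq nat) := runs (elems I).

(* Since alpha_1 = floor((i_1 - 1)/2) + 1, the general formula for alpha_r also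
   gives alpha_1 if one puts i_0 = 1. *)
Definition assoc_vector (I : {fset nat}) : seq nat :=
  pairmap (fun i j => (j - i) %/ 2 + 1) 1 (elems I).

Definition blocks (I : {fset nat}) : seq (seq nat) :=
  reshape (shape (canonical_form I)) (assoc_vector I).

(* All the integer vectors involved have positive entries, so that vectors are
   sequences of natural numbers. *)

(* Drev (alpha_r, ..., alpha_1) = D (alpha_1, ..., alpha_r) *)
Fixpoint Drev (s : seq nat) : int :=
  match s with
  | [::] => 1
  | [:: a] => a%:Z
  | a :: ((_ :: s'') as s') => (a%:Z * Drev s' - Drev s'')%R
  end.

Definition D (B : seq nat) : int := Drev (rev B).

Definition A1 (B : seq nat) : bool :=
  if B is b :: B' then (1 <= b) && all (leq 2) B' else false.

Definition bracket (B : seq nat) : rat := ((D (behead B))%:Q / (D B)%:Q)%R.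

Lemma Drev_rcons s b a :
  (Drev (rcons (rcons s b) a) = a%:Z * Drev (rcons s b) - Drev s)%R.
Proof.
have [m] := ubnP (size s); elim: m s => // m IHm [|x [|y s]] /= le_sm.
- by ring.
- by ring.
have IH1 := IHm (y :: s); rewrite /= in IH1; rewrite IH1; last lia.
have IH2 := IHm s; case: s le_sm IH1 IH2 => [|z s] /= le_sm IH1 IH2; first by ring.
by rewrite IH2; [ring|lia].
Qed.

Lemma D_cons a b s : (D (a :: b :: s) = a%:Z * D (b :: s) - D s)%R.
Proof. by rewrite /D !rev_cons Drev_rcons. Qed.

Lemma D_ge2 s : all (leq 2) s ->
  [/\ (0 < D s)%R & s != [::] -> (0 < D (behead s) < D s)%R].
Proof.
elim: s => [|a [|b s] IHs]; first by [].
  by rewrite /= andbT /D /= => a2; split=> [|_]; lia.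
rewrite /= => /andP[a2 /andP[b2 s2]].
have [|p] := IHs; first by rewrite /= b2.
rewrite D_cons; move=> /(_ isT)/= /andP[h1 h2]; split=> [|_].
  by nia.
by rewrite p /=; nia.
Qed.

Lemma D_A1 B : A1 B -> (0 < D (behead B))%R /\ (0 < D B)%R.
Proof.
case: B => [//|a [|b s]] /= /andP[a1 h]; first by rewrite /D /=; lia.
have [p /(_ isT)/= /andP[h1 h2]] := @D_ge2 (b :: s) h.
by rewrite D_cons; nia.
Qed.

Lemma bracket_gt0 B : A1 B -> (0 < bracket B)%R.
Proof. by case/D_A1 => h1 h2; rewrite /bracket divr_gt0 ?ltr0z. Qed.

Lemma bracket_lt1 B : B != [::] -> all (leq 2) B -> (0 < bracket B < 1)%R.
Proof.
move=> B0 /D_ge2[p /(_ B0)/andP[h1 h2]].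
rewrite /bracket divr_gt0 ?ltr0z //= ltr_pdivrMr ?ltr0z //.
by rewrite mul1r ltr_int.
Qed.

Lemma bracket_cons b B : B != [::] -> all (leq 2) B ->
  (bracket (b :: B) = (b%:Q - bracket B)^-1)%R.
Proof.
case: B => // a s _ h; have [p _] := D_ge2 h.
rewrite /bracket D_cons /= rmorphB rmorphM /=.
set x := (D (a :: s))%:~R%R; set y := (D s)%:~R%R.
have x0 : (x != 0 :> rat)%R by rewrite intr_eq0; lia.
rewrite -[X in (_ - X / _)%R]/y.
have -> : (b%:~R * x - y = x * (b%:~R - y / x) :> rat)%R by field.
by rewrite invfM mulrA divff // mul1r.
Qed.

Lemma c_exists_frac (a b : nat) : 0 < a -> 0 < b -> exists B,
  [/\ A1 B, bracket B = (a%:Q / b%:Q)%R & a < b -> all (leq 2) B].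
Proof.
have [m] := ubnP a; elim: m a b => // m IHm a b le_am a0 b0.
pose q := (b + a.-1) %/ a.
have hq1 : b <= q * a.
  by have := divn_eq (b + a.-1) a; have := ltn_pmod (b + a.-1) a0; rewrite -/q; lia.
have hq2 : q * a < b + a by have := leq_divM (b + a.-1) a; rewrite -/q; lia.
have q1 : 0 < q by nia.
have q2 : a < b -> 1 < q by nia.
have aQ : (a%:~R != 0 :> rat)%R by rewrite intr_eq0; lia.
have bQ : (b%:~R != 0 :> rat)%R by rewrite intr_eq0; lia.
have [e|r0] := posnP (q * a - b).
  exists [:: q]; split => [||/q2 h]; rewrite /= ?andbT //.
  have -> : b = q * a by lia.
  have qQ : (q%:~R != 0 :> rat)%R by rewrite intr_eq0; lia.
  rewrite /bracket /D /= PoszM rmorphM /=; field.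
  by rewrite aQ qQ.
have [||//|B [AB eB B2]] := IHm (q * a - b) a; [lia|lia|].
have {}B2 : all (leq 2) B by apply: B2; lia.
have B0 : B != [::] by case: (B) AB.
exists (q :: B); split=> [||/q2 h].
- by rewrite /= q1.
- rewrite bracket_cons // eB -subzn // PoszM rmorphB rmorphM /=.
  rewrite -[RHS]invf_div; congr (_^-1)%R.
  by field.
by rewrite /= h.
Qed.

Lemma c_exists (g : rat) : (0 < g)%R -> exists B, A1 B && (bracket B == g).
Proof.
move=> g0; have n0 : (0 < numq g)%R by rewrite numq_gt0.
have [||B [AB eB _]] := @c_exists_frac `|numq g| `|denq g|; rewrite ?absz_gt0.
- by rewrite lt0r_neq0.
- by rewrite denq_eq0.
exists B; rewrite AB eB /= !abszE ger0_norm ?(ltW n0) // ger0_norm.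
  by rewrite divq_num_den.
exact: ltW (denq_gt0 g).
Qed.

Lemma bracket_inj B C : A1 B -> A1 C -> bracket B = bracket C -> B = C.
Proof.
elim: B C => [//|a B IHB] [//|b C] /= /andP[a0 hB] /andP[b0 hC].
have br1 x : (bracket [:: x] = (x%:Q)^-1)%R by rewrite /bracket /D /= div1r.
have int_eq (x y : nat) (u v : rat) : (0 <= u < 1)%R -> (0 <= v < 1)%R ->
    (x%:Q - u = y%:Q - v)%R -> x = y.
  move=> hu hv e; have h1 : (x%:Q < (y + 1)%:Q)%R by rewrite PoszD rmorphD /=; lra.
  have h2 : (y%:Q < (x + 1)%:Q)%R by rewrite PoszD rmorphD /=; lra.
  by move: h1 h2; rewrite !ltr_int; lia.
pose t s := if s is [::] then 0%R else bracket s.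
have brE x s : all (leq 2) s -> (bracket (x :: s) = (x%:Q - t s)^-1)%R.
  by case: s => [|y s] h; [rewrite br1 subr0|rewrite bracket_cons].
have t01 s : all (leq 2) s -> (0 <= t s < 1)%R.
  case: s => [|y s] h; first by [].
  by case/andP: (bracket_lt1 (isT : y :: s != [::]) h) => h1 h2; rewrite /t ltW.
rewrite !brE // => /invr_inj e.
have eab := int_eq _ _ _ _ (t01 _ hB) (t01 _ hC) e.
subst b; congr cons.
have {}e : t B = t C by lra.
have A1ge2 y s : all (leq 2) (y :: s) -> A1 (y :: s).
  by move=> /= /andP[h1 h2]; rewrite h2 andbT; lia.
case: B C IHB e hB hC => [|x B] [|y C] IHB //.
- by move=> e _ h; have /andP[] := bracket_lt1 (isT : y :: C != [::]) h; rewrite -[bracket _]e ltxx.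
- by move=> e h _; have /andP[] := bracket_lt1 (isT : x :: B != [::]) h; rewrite [bracket _]e ltxx.
by move=> e h1 h2; apply: IHB e; apply: A1ge2.
Qed.

Definition c (g : rat) (g_gt0 : (0 < g)%R) : seq nat := xchoose (c_exists g_gt0).

Lemma c_A1 g (g_gt0 : (0 < g)%R) : A1 (c g_gt0).
Proof. by case/andP: (xchooseP (c_exists g_gt0)). Qed.

Lemma bracket_c g (g_gt0 : (0 < g)%R) : bracket (c g_gt0) = g.
Proof. by case/andP: (xchooseP (c_exists g_gt0)) => _ /eqP. Qed.

(* The nonzero elements of Q/Z, as fractions in (0, 1). *)
Definition letter : Type := {g : rat | (0 < g < 1)%R}.

(* The free monoid on letter: the product * is ++ and the unit is [::]. *)
Definition Gamma : Type := seq letter.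

Lemma letter_gt0 (g : letter) : (0 < val g)%R.
Proof. by case/andP: (valP g). Qed.

Definition cword (gamma : Gamma) : seq (seq nat) :=
  [seq c (letter_gt0 g) | g <- gamma].

Definition frac (x : rat) : rat := (x - (Num.floor x)%:~R)%R.

(* Here pmap insub discards the rationals outside (0, 1). By val_Pi below, the
   only one it can discard is frac (bracket B1), when this is 0. *)
Definition Pi (n : nat) : Gamma :=
  if blocks (Z n) is B1 :: Bs then
    pmap insub (frac (bracket B1) :: [seq bracket B | B <- Bs])
  else [::].

Lemma frac_itv x : (0 <= frac x < 1)%R.
Proof.
rewrite /frac; have := floor_itv x; rewrite rmorphD /= => /andP[h1 h2].
by apply/andP; split; lra.
Qed.

Lemma blocks_A1 I B1 Bs : is_2partition I -> blocks I = B1 :: Bs ->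
  A1 B1 /\ all (fun B => (B != [::]) && all (leq 2) B) Bs.
Proof.
case/andP=> I0 sI; rewrite /blocks /canonical_form /assoc_vector.
have {}I0 : 0 \notin elems I by rewrite mem_elems.
have [fl /andP[ne _]] := runsP (elems I).
have hsize : sumn (shape (runs (elems I))) = size (elems I).
  by rewrite -size_flatten fl.
have {ne} : all (leq 1) (shape (runs (elems I))).
  by rewrite all_map; apply: sub_all ne => r /= /andP[]; case: r.
move: hsize; move: (shape _) => sh; case: (elems I) I0 sI => [|i s] I0 sI.
  by case: sh => [//|[|n] sh].
case: sh => [//|[//|n] sh] /= hsize pos_sh.
have : all (leq 2) (pairmap (fun i j => (j - i) %/ 2 + 1) i s).
  elim: s i {hsize I0} sI => //= j s IHs i /andP[hij /IHs ->].
  rewrite addn1 andbT ltnS divn_gt0 //; move: hij; rewrite /gap2; lia.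
have : size (pairmap (fun i j => (j - i) %/ 2 + 1) i s) = n + sumn sh.
  by rewrite size_pairmap; lia.
move: (pairmap _ _ _) => v hv v2 [<- <-]; split.
  rewrite /= addn1 /=; move: v2; rewrite -{1}(cat_take_drop n v) all_cat.
  by case/andP.
have : all (leq 2) (flatten (reshape sh (drop n v))).
  rewrite reshapeKr ?size_drop; last by lia.
  by move: v2; rewrite -{1}(cat_take_drop n v) all_cat => /andP[].
have : all (leq 1) (shape (reshape sh (drop n v))).
  by rewrite reshapeKl // size_drop; lia.
elim: (reshape _ _) => //= B {}Bs IHB /andP[hB1 hB2].
rewrite all_cat => /andP[h1 h2]; rewrite h1 IHB // !andbT.
by case: (B) hB1.
Qed.

Lemma val_Pi n B1 Bs : blocks (Z n) = B1 :: Bs ->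
  [seq val g | g <- Pi n] =
  (if frac (bracket B1) == 0%R then [::] else [:: frac (bracket B1)])
    ++ [seq bracket B | B <- Bs].
Proof.
move=> eB; have [_ hBs] := blocks_A1 (Z_2partition n) eB.
rewrite /Pi eB pmap_filter /=; last exact: insubK.
have -> : [seq x <- [seq bracket B | B <- Bs] | (insub x : option letter)]
    = [seq bracket B | B <- Bs].
  apply/all_filterP; rewrite all_map; apply: sub_all hBs => B /= /andP[B0 B2].
  by rewrite isSome_insub /= bracket_lt1.
rewrite isSome_insub /=; have /andP[h0 ->] := frac_itv (bracket B1).
by rewrite lt_neqAle h0 !andbT eq_sym; case: eqP.
Qed.

(* A 2-partition with prescribed blocks, used to show that Pi is surjective. *)
Fixpoint unblocks (i : nat) (Bs : seq (seq nat)) : seq (seq nat) :=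
  if Bs is B :: Bs' then
    let r := scanl (fun j b => j + 2 * (b - 1)) i B in
    r :: unblocks (last i r).+1 Bs'
  else [::].

Lemma unblocksP i p Bs :
  all (fun B => (B != [::]) && all (leq 2) B) Bs -> p <= i <= p.+1 ->
  [/\ pairmap (fun i j => (j - i) %/ 2 + 1) p (flatten (unblocks i Bs))
        = flatten Bs,
      path gap2 p (flatten (unblocks i Bs)),
      shape (unblocks i Bs) = shape Bs,
      parity_runs (unblocks i Bs) &
      if unblocks i Bs is r :: _ then odd (head 0 r) = odd i else true].
Proof.
pose g j b := j + 2 * (b - 1).
elim: Bs i p => [//|B Bs IHBs] i p /= /andP[/andP[B0 B2] hBs] hip.
rewrite -/g; set r := scanl g i B.
have [] := IHBs (last i r).+1 (last i r) hBs; first by rewrite leqnn leqnSn.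
move=> IH1 IH2 IH3 IH4 IH5.
have r_odd : all (fun j => odd j == odd i) r.
  rewrite /r; elim: (B) (i) => //= b B' IHB j.
  have e : odd (g j b) = odd j by rewrite /g oddD oddM /= addbF.
  by rewrite e eqxx /=; have := IHB (g j b); rewrite e.
have r_pair q : q <= i <= q.+1 ->
    pairmap (fun i j => (j - i) %/ 2 + 1) q r = B /\ path gap2 q r.
  rewrite /r; elim: (B) (i) q B2 => //= b B' IHB j q /andP[b2 hB'] hjq.
  have [|-> ->] := IHB (g j b) (g j b) hB'; first by rewrite leqnn leqnSn.
  rewrite /gap2 /g; split; last by lia.
  by congr cons; lia.
have [rp1 rp2] := r_pair p hip.
have size_r : size r = size B by rewrite size_scanl.
have r0 : r != [::] by rewrite -size_eq0 size_r size_eq0.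
have lastE q : last q r = last i r by case: (r) r0.
have last_odd : odd (last i r) = odd i.
  by have /allP h := r_odd; case: (r) r0 h => // x r' _ h; apply/eqP/h/mem_last.
split.
- by rewrite pairmap_cat rp1 lastE IH1.
- by rewrite cat_path rp2 lastE IH2.
- by rewrite size_r IH3.
- case/andP: IH4 => a1 a2; rewrite /parity_runs /= r0 a1 andbT /=.
  apply/andP; split.
    case: (r) r_odd => //= x r' /andP[/eqP -> h]; rewrite all_map.
    by apply: sub_all h.
  case: (unblocks _ _) a2 IH5 => //= r' rs -> ->.
  by rewrite andbT lastE /= last_odd; case: odd.
by case: (r) r_odd r0 => //= x r' /andP[/eqP].
Qed.

Lemma blocks_surj Bs : all (fun B => (B != [::]) && all (leq 2) B) Bs ->
  exists2 I, is_2partition I & blocks I = Bs.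
Proof.
move=> hBs; have [//|h1 h2 h3 h4 _] := @unblocksP 1 1 Bs hBs.
pose s := flatten (unblocks 1 Bs).
have ss : sorted gap2 s := path_sorted h2.
exists [fset x in s]%fset.
  apply: is_2partition_seq => //.
  move: h2; rewrite (path_sortedE gap2_trans) => /andP[/allP h _].
  by apply/negP => /h.
rewrite /blocks /canonical_form /assoc_vector elems_seq ?sorted_gap2_ltn //.
by rewrite runs_unique // h1 h3 flattenK.
Qed.

Lemma c_ge2 (g : letter) : all (leq 2) (c (letter_gt0 g)).
Proof.
have := c_A1 (letter_gt0 g); have := bracket_c (letter_gt0 g).
case: (c _) => [//|b B] eB /= /andP[b1 hB]; rewrite hB andbT.
rewrite ltn_neqAle b1 andbT; apply/negP => /eqP e1.
have /andP[_] := valP g; rewrite -eB -e1.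
case: B hB {eB} => [|a B] hB; first by rewrite /bracket /D /= divr1 ltxx.
have /andP[h1 h2] := bracket_lt1 (isT : a :: B != [::]) hB.
rewrite bracket_cons // invf_lt1; first by lra.
by rewrite subr_gt0.
Qed.

Lemma Pi_surj (gamma : Gamma) : exists n, Pi n == gamma.
Proof.
have hc : all (fun B => (B != [::]) && all (leq 2) B) (cword gamma).
  rewrite all_map; apply/allP => g _ /=; rewrite c_ge2 andbT.
  by have := c_A1 (letter_gt0 g); case: (c _).
have [I hI eI] := blocks_surj hc.
exists (fibsum I).
have ZI : Z (fibsum I) = I.
  by apply: zeckendorf_unique; rewrite ?Z_2partition ?fibsum_Z.
rewrite /Pi ZI eI; case: gamma {hc eI} => [//|g gamma] /=.
rewrite -map_comp (eq_map (g := val)); last first.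
  by move=> h /=; rewrite bracket_c.
have -> : frac (bracket (c (letter_gt0 g))) = val g.
  rewrite bracket_c /frac; have /andP[h0 h1] := valP g.
  by rewrite (floor_def (m := 0)) ?subr0 // (ltW h0) add0r.
by rewrite valK /= map_pK //; apply: valK.
Qed.

Definition theta (gamma : Gamma) : nat := ex_minn (Pi_surj gamma).

Definition essential (n : nat) : Prop := n = theta (Pi n).

(* On the vectors considered each entry is positive, so that the subtraction is
   never truncated. *)
Definition d (B : seq nat) : nat := sumn B - size B.

Definition eps (B : seq nat) : {fset nat} :=
  [fset (2 * d (take k B) + 1)%N | k in iota 1 (size B)]%fset.

Definition sigma (m : nat) (I : {fset nat}) : {fset nat} :=
  [fset (m + i)%N | i in I]%fset.

Definition epsw (Bs : seq (seq nat)) : {fset nat} :=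
  (\bigcup_(j <- iota 0 (size Bs))
     sigma (\sum_(B <- take j Bs) 2 * d B + j)%N (eps (nth [::] Bs j)))%fset.

Definition tau (R : realType) : R := ((1 + Num.sqrt 5) / 2)%R.

(* Main.v *)
(* A 2-partition is determined by its blocks and the parity of its least
   element, namely it is [unblocks 1 Bs] or [unblocks 2 Bs]; write [bsum i Bs]
   for the sum of the Fibonacci numbers indexed by [unblocks i Bs].  Among the
   n with pi(n) = g_1 * ... * g_s, the first block may be replaced by c(g_1)
   (or dropped if its bracket is an integer) and the least element made odd,
   and each of these operations only lowers the sum; hence
   theta(gamma) = bsum 1 (c(gamma)).  The entries of c(gamma) are all at least
   2, so its least element is odd and at least 3, which characterises essential
   numbers.

   For (c), every m > 0 is a sum of f_j over indices j >= 0 with gaps at least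
   2 and even least index.  As f_j tau - f_(j+1) = (-1)^j tau^-(j+1), for such a
   sum floor(m tau) is the sum of the f_(j+1), and
   floor(m tau) + floor(m tau^2) = 2 floor(m tau) + m is the sum of the
   f_(j+3). *)

Require Import Defs.
From mathcomp Require Import all_boot all_order all_algebra finmap.
From mathcomp Require Import reals.
From mathcomp Require Import zify ring lra.

Set Implicit Arguments.
Unset Strict Implicit.
Unset Printing Implicit Defensive.

Import Order.TTheory GRing.Theory Num.Theory.

Local Open Scope nat_scope.

(* [all_algebra] shadows this name by the fractions of fraction.v. *)
Local Notation frac := Defs.frac.
Local Notation step := (fun j b => j + 2 * (b - 1)).
Local Notation gap := (fun i j => (j - i) %/ 2 + 1).
Local Notation proper_blocks := (all (fun B => (B != [::]) && all (leq 2) B)).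

(** * Fibonacci sums of prescribed blocks *)

Definition bsum (i : nat) (Bs : seq (seq nat)) : nat :=
  \sum_(j <- flatten (unblocks i Bs)) fib j.

Lemma last_scanl_step i B : last i (scanl step i B) = foldl step i B.
Proof. by elim: B i => //= b B IHB i; rewrite -IHB; case: (B). Qed.

Lemma bsum_cons i B Bs : bsum i (B :: Bs) =
  \sum_(j <- scanl step i B) fib j + bsum (foldl step i B).+1 Bs.
Proof. by rewrite /bsum /= big_cat last_scanl_step. Qed.

Lemma leq_foldl_step i j B : i <= j -> foldl step i B <= foldl step j B.
Proof. by elim: B i j => //= b B IHB i j ij; apply: IHB; rewrite leq_add2r. Qed.

Lemma leq_bsum i j Bs : i <= j -> bsum i Bs <= bsum j Bs.
Proof.
elim: Bs i j => [//|B Bs IHBs] i j ij.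
rewrite !bsum_cons leq_add ?IHBs ?ltnS ?leq_foldl_step //.
elim: B i j ij => [//|b B IHB] i j ij /=; rewrite !big_cons.
by rewrite leq_add ?IHB ?leq_fib ?leq_add2r.
Qed.

(** Without [B] the remaining blocks start at a smaller index. *)
Lemma bsum_le_cons i B Bs : bsum i Bs <= bsum i (B :: Bs).
Proof.
rewrite bsum_cons; apply: leq_trans (leq_addl _ _); apply: leq_bsum.
apply: leqW; elim: B i => //= b B IHB i.
exact: leq_trans (leq_addr _ _) (IHB _).
Qed.

(** The entry 1 makes no step, so [i] itself is the first index; the step of [b.+1] from [i] is that
    of [b] from [i.+2]. *)
Lemma bsum_cons1 i b B Bs : 0 < b ->
  bsum i ((1 :: b.+1 :: B) :: Bs) = fib i + bsum i.+2 ((b :: B) :: Bs).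
Proof.
move=> b0; rewrite !bsum_cons /= !big_cons subnn muln0 addn0.
have -> : i + 2 * (b.+1 - 1) = i.+2 + 2 * (b - 1) by lia.
by rewrite !addnA.
Qed.

(** * Brackets modulo 1 *)

Lemma frac_addr1 (x : rat) : (frac (1 + x) = frac x)%R.
Proof. by rewrite /frac floorDzr ?rpred1 // floor1 rmorphD /=; lra. Qed.

Lemma frac_id (x : rat) : (0 <= x < 1)%R -> frac x = x.
Proof. by move=> h; rewrite /frac (floor_def (m := 0)) ?subr0. Qed.

(** [D (1 :: b.+1 :: B)] equals [D (b :: B)], and [D (b.+1 :: B)] equals [D (b :: B) + D B]. *)
Lemma bracket_cons1 b B : 0 < b -> all (leq 2) B ->
  (bracket (1%N :: b.+1 :: B) = 1 + bracket (b :: B))%R.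
Proof.
move=> b0 hB; have [_] : (0 < D B)%R /\ (0 < D (b :: B))%R.
  by apply: (@D_A1 (b :: B)); rewrite /= b0.
have e : (D (b.+1 :: B) = D (b :: B) + D B)%R.
  case: B hB => [|a B] _; first by rewrite /D /=; lia.
  by rewrite !D_cons; lia.
move=> p; rewrite /bracket /= D_cons e.
have -> : (1%:Z * (D (b :: B) + D B) - D B = D (b :: B))%R by ring.
have x0 : ((D (b :: B))%:~R != 0 :> rat)%R by rewrite intr_eq0; lia.
by rewrite rmorphD /=; field.
Qed.

(* An entry 1 in front stands for the integral part: passing from
   (1, b + 1, ...) to (b, ...) lowers the bracket by 1, and drops the smallest
   index while moving the others down by 2. *)
Lemma bsum_reduce i B g Bs : A1 B -> frac (bracket B) = val (g : letter) ->
  bsum i (c (letter_gt0 g) :: Bs) <= bsum i (B :: Bs).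
Proof.
have [m] := ubnP (size B); elim: m B i => // m IHm [//|b B] i /= le_m.
move=> /andP[b1 hB] eB; have [b2|b2] := leqP 2 b.
  have h2 : all (leq 2) (b :: B) by rewrite /= b2.
  have /andP[h0 h1] := bracket_lt1 (isT : b :: B != [::]) h2.
  rewrite (@bracket_inj (c (letter_gt0 g)) (b :: B)) ?c_A1 //=; first by rewrite b1.
  by rewrite bracket_c -eB frac_id // (ltW h0).
have {b1 b2} b1 : b = 1 by lia.
subst b; case: B hB eB le_m => [|[//|a] B].
  (* The one-entry block 1 has bracket 1, whose fractional part 0 is not a letter. *)
  have : (0 < frac (bracket [:: 1]))%R -> false.
    by rewrite /bracket /D /= divr1 /frac floor1 subrr ltxx.
  by move=> h _ eB _; move: h; rewrite eB letter_gt0 => /(_ isT).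
move=> /= /andP[a1 hB] eB le_m.
have {}a1 : 0 < a by lia.
have {}eB : frac (bracket (a :: B)) = val g by rewrite -[RHS]eB bracket_cons1 ?frac_addr1.
rewrite bsum_cons1 //; apply: leq_trans (leq_addl _ _).
have /leq_trans -> // : bsum i (c (letter_gt0 g) :: Bs) <= bsum i ((a :: B) :: Bs).
  by apply: IHm; rewrite //= a1.
by apply: leq_bsum; lia.
Qed.

(** * Recovering a 2-partition from its blocks *)

(** Halved gaps forget parities, but the parity is constant on a run and flips at the next one. Here
    [p] is the previous index and [i] is whichever of [p], [p.+1] has the parity of the next index
    [j], so that [i + 2 * ((j - p) %/ 2)] is exactly [j]. *)
Lemma unblocks_runs i p rs : parity_runs rs -> path leq p (flatten rs) ->
  p <= i <= p.+1 -> (rs != [::] -> odd (head 0 (flatten rs)) = odd i) ->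
  unblocks i (reshape (shape rs) (pairmap gap p (flatten rs))) = rs.
Proof.
elim: rs i p => [//|r rs IHrs] i p /andP[/= /andP[/andP[r0 cr] ar] sr].
rewrite cat_path => /andP[pr prs] pi oi.
rewrite pairmap_cat take_size_cat ?size_pairmap // drop_size_cat ?size_pairmap //.
have scanE : scanl step i (pairmap gap p r) = r.
  have {oi} : all (fun j => odd j == odd i) r.
    case: (r) r0 cr oi => //= j r' _ cr' /(_ isT) <-; rewrite eqxx /=.
    by move: cr'; rewrite all_map.
  elim: (r) (i) (p) pr pi => [//|j r' IHr] i' p' /=.
  move=> /andP[pj jr] pi' /andP[/eqP oj ar'].
  have -> : i' + 2 * ((j - p') %/ 2 + 1 - 1) = j by lia.
  congr cons; apply: IHr; rewrite ?leqnn ?leqnSn //.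
  by apply: sub_all ar' => k; rewrite oj.
rewrite scanE; congr cons; have lE : last i r = last p r by case: (r) r0.
rewrite lE; apply: IHrs.
- by rewrite /parity_runs ar (path_sorted sr).
- by [].
- by rewrite leqnn leqnSn.
case: rs sr ar {prs oi} => [//|[//|k r'] rs] /= /andP[h _] _ _.
move: h; have -> : last 0 r = last p r by case: (r) r0.
by do 2!case: odd.
Qed.

Lemma elems_unblocks I : is_2partition I ->
  elems I = flatten (unblocks (if odd (head 0 (elems I)) then 1 else 2) (blocks I)).
Proof.
case/andP=> I0 sI; rewrite /blocks /canonical_form /assoc_vector.
have [fl pr] := runsP (elems I).
rewrite -{4}fl unblocks_runs ?fl //; last 2 first.
- by case: ifP.
- by move=> _; case: ifP.
have : 0 \notin elems I by rewrite mem_elems.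
case: (elems I) sI => //= i s si; rewrite inE negb_or => /andP[i0 _].
apply/andP; split; first by lia.
by apply: sub_path si => a b; rewrite /gap2; lia.
Qed.

Lemma Z_fibsum I : is_2partition I -> Z (fibsum I) = I.
Proof. by move=> hI; apply: zeckendorf_unique; rewrite ?Z_2partition ?fibsum_Z. Qed.

Lemma elems_Z_seq s : 0 \notin s -> sorted gap2 s ->
  elems (Z (\sum_(i <- s) fib i)) = s.
Proof.
move=> s0 ss; have e := elems_seq (sorted_gap2_ltn ss).
by rewrite -{1}e -fibsum_elems Z_fibsum ?e // is_2partition_seq.
Qed.

Lemma elems_Z_bsum Bs : proper_blocks Bs ->
  elems (Z (bsum 1 Bs)) = flatten (unblocks 1 Bs).
Proof.
move=> hBs; have [//|_ h _ _ _] := @unblocksP 1 1 Bs hBs.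
apply: elems_Z_seq (path_sorted h).
move: h; rewrite (path_sortedE gap2_trans) => /andP[/allP h _].
by apply/negP => /h.
Qed.

Lemma blocks_Z_bsum Bs : proper_blocks Bs -> blocks (Z (bsum 1 Bs)) = Bs.
Proof.
move=> hBs; have [//|h1 _ h3 h4 _] := @unblocksP 1 1 Bs hBs.
rewrite /blocks /canonical_form /assoc_vector elems_Z_bsum //.
by rewrite runs_unique // h1 h3 flattenK.
Qed.

(** * The least element of a fibre of [Pi] *)

Lemma cword_proper gamma : proper_blocks (cword gamma).
Proof.
rewrite all_map; apply/allP => g _ /=; rewrite c_ge2 andbT.
by have := c_A1 (letter_gt0 g); case: (c _).
Qed.

Lemma bracket_cword gamma : [seq bracket B | B <- cword gamma] = map val gamma.
Proof. by rewrite -map_comp; apply: eq_map => g /=; rewrite bracket_c. Qed.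

Lemma cword_bracket Bs gamma : proper_blocks Bs ->
  [seq bracket B | B <- Bs] = map val (gamma : Gamma) -> cword gamma = Bs.
Proof.
elim: Bs gamma => [|B Bs IHBs] [|g gamma] //= /andP[/andP[B0 B2] hBs] [eg e].
congr cons; last exact: IHBs.
apply: bracket_inj; rewrite ?c_A1 ?bracket_c //.
by case: B B0 B2 {eg} => //= b B _ /andP[b2 ->]; rewrite andbT; lia.
Qed.

Lemma Pi_bsum gamma : Pi (bsum 1 (cword gamma)) = gamma.
Proof.
have hc := cword_proper gamma; apply: (inj_map val_inj).
case: gamma hc => [|g gamma] hc.
  by rewrite /Pi blocks_Z_bsum.
rewrite (val_Pi (blocks_Z_bsum hc)) bracket_c bracket_cword.
have /andP[h0 h1] := valP g; rewrite frac_id ?(ltW h0) //.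
by rewrite gt_eqF.
Qed.

Lemma bsum_le n : bsum 1 (cword (Pi n)) <= n.
Proof.
case eB: (blocks (Z n)) => [|B Bs]; first by rewrite /Pi eB /bsum /= big_nil.
have [hB hBs] := blocks_A1 (Z_2partition n) eB.
have le_n : bsum 1 (B :: Bs) <= n.
  rewrite -[n in X in _ <= X]fibsum_Z fibsum_elems elems_unblocks ?Z_2partition //.
  by rewrite eB; apply: leq_bsum; case: ifP.
(* In the first case the bracket of [B] is an integer, so [Pi n] has no letter for it. *)
apply: leq_trans le_n; move: (val_Pi eB); case: eqP => [_|_].
  by move=> /esym/(cword_bracket hBs) ->; apply: bsum_le_cons.
case: (Pi n) => [//|g gamma] [/esym eg /esym/(cword_bracket hBs) /= ->].
exact: bsum_reduce.
Qed.

Lemma theta_bsum gamma : theta gamma = bsum 1 (cword gamma).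
Proof.
rewrite /theta; case: ex_minnP => n /eqP <- nmin; apply/eqP; rewrite eqn_leq bsum_le.
by rewrite nmin ?Pi_bsum.
Qed.

(** * The indices given by epsilon *)

Lemma d_cons b B : 0 < b -> all (leq 2) B -> d (b :: B) = b - 1 + d B.
Proof.
move=> b0 hB; rewrite /d /=.
suff : size B <= sumn B by lia.
by elim: B hB => //= a B IHB /andP[a2 /IHB]; lia.
Qed.

Lemma foldl_step i B : all (leq 2) B -> foldl step i B = i + 2 * d B.
Proof.
elim: B i => [|b B IHB] i /=; first by rewrite addn0.
by move=> /andP[b2 hB]; rewrite IHB // d_cons //; lia.
Qed.

Lemma scanl_step i B : all (leq 2) B ->
  scanl step i B = [seq i + 2 * d (take k B) | k <- iota 1 (size B)].
Proof.
elim: B i => [//|b B IHB] i /= /andP[b2 hB].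
have d0 : d [::] = 0 by [].
rewrite take0 d_cons ?d0 ?addn0 //; last by lia.
congr cons.
rewrite IHB // (iotaDl 1 1) -map_comp; apply: eq_map => k /=.
have hk : all (leq 2) (take k B).
  by move: hB; rewrite -{1}(cat_take_drop k B) all_cat => /andP[].
by rewrite add0n d_cons //; lia.
Qed.

Lemma mem_epsP B x :
  reflect (exists2 k, k \in iota 1 (size B) & x = 2 * d (take k B) + 1)
          (x \in eps B).
Proof. by apply: (iffP (imfsetP _ _ _ _)) => -[k kB ->]; exists k. Qed.

(** Each earlier block moves the start by twice its [d], plus 1 for the change of parity; the ones
    add up to [j]. *)
Lemma mem_unblocks o Bs x : all (all (leq 2)) Bs ->
  reflect (exists j y, [/\ j < size Bs, y \in eps (nth [::] Bs j)
             & x = o + (\sum_(B <- take j Bs) 2 * d B + j) + y])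
          (x \in flatten (unblocks o.+1 Bs)).
Proof.
elim: Bs o x => [|B Bs IHBs] o x /= hBs.
  by apply: ReflectF => -[j [y []]].
case/andP: hBs => hB hBs; rewrite mem_cat last_scanl_step foldl_step // scanl_step //.
apply: (iffP orP) => [[/mapP[k kB ->]|]|[[|j] [y [jB yB ->]]]].
- exists 0, (2 * d (take k B) + 1); split=> //; last by rewrite take0 big_nil; lia.
  by apply/mem_epsP; exists k.
- rewrite addSn => /(IHBs _ _ hBs)[j [y [jB yB ->]]]; exists j.+1, y; split=> //.
  by rewrite /= big_cons; lia.
- left; case/mem_epsP: yB => k kB ->; apply/mapP; exists k => //.
  by rewrite take0 big_nil /=; lia.
- right; rewrite addSn; apply/(IHBs _ _ hBs); exists j, y; split=> //.
  by rewrite /= big_cons; lia.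
Qed.

Lemma fibsum_epsw Bs : proper_blocks Bs -> fibsum (epsw Bs) = bsum 1 Bs.
Proof.
move=> hBs; have hBs2 : all (all (leq 2)) Bs by apply: sub_all hBs => B /andP[].
have -> : epsw Bs = [fset x in flatten (unblocks 1 Bs)]%fset.
  apply/fsetP => x; rewrite in_fset; apply/bigfcupP/mem_unblocks => //.
    move=> [j]; rewrite andbT mem_iota add0n => jB /imfsetP[y /= yB ->].
    by exists j, y.
  move=> [j [y [jB yB ->]]]; exists j; first by rewrite andbT mem_iota.
  by apply/imfsetP; exists y.
have [//|_ h _ _ _] := @unblocksP 1 1 Bs hBs.
by rewrite fibsum_elems elems_seq // sorted_gap2_ltn // (path_sorted h).
Qed.

(** * Essential numbers by their least Zeckendorf index *)

Lemma elems_Z0 : elems (Z 0) = [::].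
Proof. by have := @elems_Z_seq [::] isT isT; rewrite big_nil. Qed.

Lemma essentialE n : essential n <-> n = 0 \/ (odd (mu 1 n) /\ 3 <= mu 1 n).
Proof.
rewrite /essential theta_bsum /mu nth0; split=> [|[->|[on n3]]].
- case: (Pi n) (cword_proper (Pi n)) => [|g gamma] hc e.
    by left; rewrite e /bsum /= big_nil.
  (* The least index is [1 + 2 * (b - 1)], where [b >= 2] is the first entry. *)
  right; rewrite e elems_Z_bsum //=.
  have := c_ge2 g; have := c_A1 (letter_gt0 g); case: (c _) => //= b B _ /andP[b2 _].
  by split; lia.
- by rewrite /Pi /blocks /canonical_form elems_Z0 /bsum /= big_nil.
have hZ := Z_2partition n; have := elems_unblocks hZ; rewrite on.
case eB: (blocks (Z n)) => [|B Bs] eZ; first by rewrite eZ in on.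
have [hB hBs] := blocks_A1 hZ eB.
(* A least index of at least 3 makes the first entry at least 2, so the first bracket lies in (0, 1)
   and reduction modulo 1 leaves it alone. *)
have hB2 : all (leq 2) B.
  case: B hB eB eZ => //= b B /andP[_ ->] eB eZ; rewrite andbT.
  by move: n3; rewrite eZ /=; lia.
have B0 : B != [::] by case: (B) hB.
have := val_Pi eB; have /andP[h0 h1] := bracket_lt1 B0 hB2.
rewrite frac_id ?(ltW h0) // gt_eqF //= => /esym e.
rewrite (@cword_bracket (B :: Bs)) //=; last by rewrite B0 hB2.
by rewrite -[LHS]fibsum_Z fibsum_elems eZ.
Qed.

(** * The golden ratio and the floor formula *)

Lemma sum_fib3 s :
  \sum_(i <- s) fib i.+3 = 2 * \sum_(i <- s) fib i.+1 + \sum_(i <- s) fib i.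
Proof.
rewrite big_distrr -big_split /=; apply: eq_bigr => i _.
by rewrite !fibSS; lia.
Qed.

(** Index 0 is allowed so that an odd least index can be expanded into even ones; evenness makes the
    error in [floor_sum_fib_tau] positive. *)
Lemma even_zeckendorf m : 0 < m -> exists j s,
  [/\ ~~ odd j, path gap2 j s & m = \sum_(i <- j :: s) fib i].
Proof.
move=> m0; have /andP[Z0 sZ] := Z_2partition m.
have eZ : m = \sum_(i <- elems (Z m)) fib i by rewrite -fibsum_elems fibsum_Z.
case: (elems (Z m)) sZ eZ => [|i s]; first by rewrite big_nil; lia.
case oi: (odd i) => /= si ->; last by exists i, s; rewrite oi.
rewrite (_ : i = (i./2).*2.+1) in si *; last by lia.
have {si} : path gap2 (i./2).*2 s by case: s si => //= k s; rewrite /gap2; lia.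
(* fib (2 k + 1) = fib 0 + fib 2 + ... + fib (2 k) *)
elim: (i./2) s {m m0 Z0 oi} => [|k IHk] s ks; first by exists 0, s; rewrite !big_cons.
have [|j [t [oj jt e]]] := IHk (k.+1.*2 :: s); first by rewrite /= ks /gap2; lia.
exists j, t; split=> //; rewrite -e !big_cons doubleS fibSS; lia.
Qed.

Local Open Scope ring_scope.

Lemma tau_sqr (R : realType) : tau R ^+ 2 = tau R + 1.
Proof.
have h : Num.sqrt (5 : R) ^+ 2 = 5 by rewrite sqr_sqrtr.
by rewrite /tau expr_div_n sqrrD h; field.
Qed.

Lemma tau_itv (R : realType) : 1 < tau R < 2.
Proof.
have h : Num.sqrt (5 : R) ^+ 2 = 5 by rewrite sqr_sqrtr.
by have := sqrtr_ge0 (5 : R); rewrite /tau; move: h; set s := Num.sqrt _ => h s0; nra.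
Qed.

(** With x = tau - 1 one has x^2 = 1 - x, so both sides satisfy the Fibonacci recurrence. *)
Lemma fib_tau (R : realType) j :
  (fib j)%:R * tau R - (fib j.+1)%:R = (-1) ^+ j * (tau R - 1) ^+ j.+1.
Proof.
have h := tau_sqr R.
suff: (fib j)%:R * tau R - (fib j.+1)%:R = (-1) ^+ j * (tau R - 1) ^+ j.+1 /\
      (fib j.+1)%:R * tau R - (fib j.+2)%:R = (-1) ^+ j.+1 * (tau R - 1) ^+ j.+2.
  by case.
elim: j => [|j [IH1 IH2]]; first by rewrite !fibSS /fib; split; rewrite ?expr1 ?sqrrB ?h; ring.
split=> //.
have -> : (fib j.+2)%:R * tau R - (fib j.+3)%:R =
    ((fib j.+1)%:R * tau R - (fib j.+2)%:R) + ((fib j)%:R * tau R - (fib j.+1)%:R).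
  by rewrite (fibSS j.+1) (fibSS j) !natrD; ring.
rewrite IH1 IH2 !exprS; set u := _ ^+ j; set v := _ ^+ j.
have -> : (tau R - 1) * ((tau R - 1) * ((tau R - 1) * v)) =
    (tau R - 1) * v * (tau R ^+ 2 - 2 * tau R + 1) by ring.
by rewrite h; ring.
Qed.

(* The error of [fib_tau] is dominated by the smallest index, since
   x^(k+1) + x^(k+3) + ... = x^k for x = tau - 1. *)
Lemma sum_fib_tau (R : realType) j s : path gap2 j s ->
  0 < (-1) ^+ j * \sum_(i <- j :: s) (-1) ^+ i * (tau R - 1) ^+ i.+1
    < (tau R - 1) ^+ j.
Proof.
have h := tau_sqr R; have /andP[t1 t2] := tau_itv R.
set x := tau R - 1.
have x2 : x ^+ 2 = 1 - x by rewrite /x sqrrB h; ring.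
have x01 : 0 < x < 1 by rewrite /x; apply/andP; split; lra.
have /andP[x0 x1] := x01.
have sgn2 k : (-1) ^+ k * (-1) ^+ k = 1 :> R by rewrite -expr2 sqrr_sign.
elim: s j => [|k s IHs] j.
  rewrite big_seq1 mulrA sgn2 mul1r => _; rewrite exprn_gt0 //= exprS.
  by rewrite gtr_pMl ?exprn_gt0.
move=> /= /andP[jk /IHs]; rewrite big_cons mulrDr mulrA sgn2 mul1r.
set S := \sum_(_ <- _) _ => /andP[S0 S1].
have xj : x ^+ j.+2 = x ^+ j - x ^+ j.+1.
  by rewrite -addn2 exprD x2 exprS; ring.
have xj3 : x ^+ j.+3 < x ^+ j.+1 by rewrite ltr_iXn2l.
have xle m : (m <= k)%N -> x ^+ k <= x ^+ m.
  by move=> mk; rewrite ler_wiXn2l ?ltW.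
(* Equal parity: [k >= j + 2], and the tail has the sign of the first term and is less than
   [x ^+ j.+2] in size. *)
have [ojk|ojk] := eqVneq (odd j) (odd k).
  have e : (-1) ^+ j = (-1) ^+ k :> R by rewrite -(signr_odd R j) ojk signr_odd.
  have := xle j.+2 ltac:(move: jk; rewrite /gap2; lia).
  have : 0 < x ^+ j.+1 by rewrite exprn_gt0.
  by rewrite e => ? ?; apply/andP; split; lra.
(* Opposite parity: [k >= j + 3], and the tail has the opposite sign but is too small to cancel
   [x ^+ j.+1]. *)
have e : (-1) ^+ j = - (-1) ^+ k :> R.
  rewrite -(signr_odd R j) -(signr_odd R k).
  by move: ojk; do 2!case: odd => //=; rewrite ?expr0 ?expr1 ?opprK.
have := xle j.+3 ltac:(move: jk ojk; rewrite /gap2; lia).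
have : 0 < x ^+ j.+2 by rewrite exprn_gt0.
by rewrite e mulNr => ? ?; apply/andP; split; lra.
Qed.

(** For even [j] the error lies strictly between 0 and [(tau R - 1) ^+ j], hence in (0, 1). *)
Lemma floor_sum_fib_tau (R : realType) j s : path gap2 j s -> ~~ odd j ->
  Num.floor ((\sum_(i <- j :: s) fib i)%N%:R * tau R)
    = (\sum_(i <- j :: s) fib i.+1)%N%:Z.
Proof.
move=> js ej; have := sum_fib_tau R js.
rewrite (eq_bigr _ (fun i _ => esym (fib_tau R i))).
rewrite -signr_odd (negbTE ej) expr0 mul1r sumrB -mulr_suml -!natr_sum => /andP[h0 h1].
have le1 : (tau R - 1) ^+ j <= 1.
  by have /andP[t1 t2] := tau_itv R; rewrite exprn_ile1 //; lra.
by apply: floor_def; rewrite rmorphD /= -!pmulrn; apply/andP; split; lra.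
Qed.

Lemma floor_tau_sqr (R : realType) m : Num.floor (m%:R * tau R) + Num.floor (m%:R * tau R ^+ 2)
  = 2 * Num.floor (m%:R * tau R) + m%:Z.
Proof.
have fm : Num.floor (m%:R : R) = m%:Z by rewrite pmulrn intrKfloor.
by rewrite tau_sqr mulrDr mulr1 floorDrz ?natr_int // fm; ring.
Qed.

Lemma floor_tauE (R : realType) n : (n = 0%N \/ odd (mu 1 n) /\ (3 <= mu 1 n)%N) <->
  exists m : nat, n%:Z = Num.floor (m%:R * tau R) + Num.floor (m%:R * tau R ^+ 2).
Proof.
split=> [[->|[on n3]]|[m]].
- by exists 0%N; rewrite !mul0r floor0.
- have /andP[_ sZ] := Z_2partition n.
  have eZ : n = (\sum_(i <- elems (Z n)) fib i)%N by rewrite -fibsum_elems fibsum_Z.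
  move: on n3; rewrite /mu; case: (elems (Z n)) sZ eZ => //= i s si eZ oi i3.
  (* Indices of at least 3 can all be lowered by 3, which turns the odd least index into an even
     one. *)
  have sub3 k u : (3 <= k)%N -> path gap2 k u ->
      exists2 t, path gap2 (k - 3)%N t & u = map (addn 3) t.
    elim: u k => [|l u IHu] k k3; first by exists [::].
    move=> /= /andP[kl lu]; rewrite /gap2 in kl.
    have [|t lt ->] := IHu l _ lu; first by lia.
    exists (l - 3 :: t)%N; last by rewrite /= subnKC //; lia.
    by rewrite /= lt andbT /gap2; lia.
  have [t jt e] := sub3 i s i3 si; set j := (i - 3)%N in jt.
  have oj : ~~ odd j by rewrite /j; lia.
  have {}e : i :: s = map (addn 3) (j :: t) by rewrite /= e subnKC.
  exists (\sum_(i <- j :: t) fib i)%N; rewrite floor_tau_sqr floor_sum_fib_tau //.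
  rewrite eZ e big_map sum_fib3; lia.
have [->|m0] := posnP m.
  by rewrite !mul0r floor0 => -[->]; left.
have [j [s [oj js ->]]] := even_zeckendorf m0.
rewrite floor_tau_sqr floor_sum_fib_tau // => en; right.
(* The indices raised by 3 are the Zeckendorf indices of [n], with odd least index [j + 3]. *)
have -> : n = (\sum_(i <- map (addn 3) (j :: s)) fib i)%N.
  by rewrite big_map sum_fib3; lia.
rewrite /mu elems_Z_seq ?nth0 /=; first by split; lia.
- by rewrite inE negb_or /=; apply/mapP => -[].
rewrite path_map; apply: sub_path js => a b; rewrite /gap2 /=; lia.
Qed.

Theorem theorem3p4 (R : realType) :
  [/\ (forall gamma : Gamma, (1 <= size gamma)%N ->
         theta gamma = fibsum (epsw (cword gamma))),
      (forall n : nat,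
         essential n <-> n = 0%N \/ (odd (mu 1 n) /\ (3 <= mu 1 n)%N)) &
      (forall n : nat,
         essential n <-> exists m : nat,
           (n%:Z = Num.floor (m%:R * tau R) + Num.floor (m%:R * tau R ^+ 2))%R)].
Proof.
split=> [gamma _|n|n].
- by rewrite theta_bsum fibsum_epsw ?cword_proper.
- exact: essentialE.
- exact: iff_trans (essentialE n) (floor_tauE R n).
Qed.
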